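(* Let $\Gamma=H_1*_K H_2$ be an amalgamated free product of abstract groups, where $K$ is a common subgroup of $H_1$ and $H_2$, and let $p$ be a prime. Then the following are equivalent: (a) The splitting has exact pro-$p$ entrance, i.e. the natural maps identify $\widehat\Gamma_p$ with $\widehat{(H_1)}_p\amalg_{\widehat K_p}\widehat{(H_2)}_p$ as a proper pro-$p$ amalgamated free product. (b) The subgroup $K$ is $p$-embedded in both $H_1$ and $H_2$, and $H_1,H_2$ are $p$-embedded in $\Gamma$. In this case, taking all closures (of the images of the groups) in $\widehat\Gamma_p$, one has $\overline{H_1}\cap\overline{H_2}=\overline K$.
   Context: $\widehat G_p$ denotes the pro-$p$ completion of an abstract group $G$. A subgroup $S\leq R$ is $p$-embedded in $R$ if the pro-$p$ topology of $R$ induces the full pro-$p$ topology on $S$: for every normal subgroup $U\triangleleft S$ of finite $p$-power index there is a normal subgroup $N\triangleleft R$ of finite $p$-power index with $N\cap S\leq U$. For pro-$p$ groups $G_1,G_2$ with a common closed subgroup $A$, $G_1\amalg_A G_2$ is the pushout of $G_1\leftarrow A\rightarrow G_2$ in the category of pro-$p$ groups; it is proper if the canonical maps $G_i\to G_1\amalg_A G_2$ are injective. Exact pro-$p$ entrance thus means: the natural maps $\widehat K_p\to\widehat{(H_i)}_p$ are injective (so that $\widehat K_p$ is a common closed subgroup), the resulting pro-$p$ amalgam $\widehat{(H_1)}_p\amalg_{\widehat K_p}\widehat{(H_2)}_p$ is proper, and the natural map from it to $\widehat\Gamma_p$ induced by the inclusions $H_i\hookrightarrow\Gamma$ is an isomorphism.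 *)

(* Defs.v *)
From HB Require Import structures.
From mathcomp Require Import all_boot all_classical topology.
From mathcomp Require fingroup.

Set Implicit Arguments.
Unset Strict Implicit.
Unset Printing Implicit Defensive.

Local Open Scope classical_set_scope.
Local Open Scope card_scope.
Local Open Scope group_scope.

(* {hom G -> H} bundles preservation of both the product and 1. *)
Notation "{ 'hom' G -> H }" := (UMagmaMorphism.type G%type H%type)
  (at level 0, G at level 98, H at level 99,
   format "{ 'hom'  G  ->  H }") : type_scope.

Section Subgroups.
Context {G : groupType}.
Implicit Types (S U N : set G) (x y : G).

Definition is_subgroup S : Prop :=
  [/\ S 1, forall x y, S x -> S y -> S (x * y) & forall x, S x -> S x^-1].

Definition is_normal_in S U : Prop :=
  [/\ is_subgroup U, U `<=` S & forall x u, S x -> U u -> U (u ^ x)].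

Definition left_coset x U : set G := [set x * u | u in U].

(* For p prime, [p.-nat n] says that n is a power of p (lemma p_natP). *)
Definition has_p_power_index (p : nat) S U : Prop :=
  exists2 n : nat, p.-nat n & [set left_coset x U | x in S] #= `I_n.

Definition p_normal (p : nat) S : set (set G) :=
  [set U | is_normal_in S U /\ has_p_power_index p S U].

Definition p_embedded (p : nat) S : Prop :=
  forall U, p_normal p S U ->
  exists2 N, p_normal p [set: G] N & N `&` S `<=` U.

End Subgroups.

(* [Gamma] with [j1], [j2] is the pushout of the inclusions [k1], [k2]. *)
Definition is_amalgam (K H1 H2 Gamma : groupType)
    (k1 : {hom K -> H1}) (k2 : {hom K -> H2})
    (j1 : {hom H1 -> Gamma}) (j2 : {hom H2 -> Gamma}) : Prop :=
  [/\ injective k1, injective k2, j1 \o k1 =1 j2 \o k2 &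
   forall (T : groupType) (f1 : {hom H1 -> T}) (f2 : {hom H2 -> T}),
     f1 \o k1 =1 f2 \o k2 ->
   exists f : {hom Gamma -> T},
     [/\ f \o j1 =1 f1, f \o j2 =1 f2 &
      forall g : {hom Gamma -> T}, g \o j1 =1 f1 -> g \o j2 =1 f2 -> g =1 f]].

HB.mixin Record isTopologicalGroup G of Topological G & Group G := {
  mulg_continuous : continuous (fun xy : G * G => xy.1 * xy.2);
  invg_continuous : continuous (fun x : G => x^-1)
}.

#[short(type="topologicalGroupType")]
HB.structure Definition TopologicalGroup :=
  { G of Topological G & Group G & isTopologicalGroup G }.

(* Profinite: compact, Hausdorff, with a base at 1 of open subgroups;
   pro-p: moreover every open normal subgroup has p-power index. *)
Definition is_pro_p (p : nat) (G : topologicalGroupType) : Prop :=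
  [/\ compact [set: G], hausdorff_space G,
      forall A : set G, nbhs 1 A ->
        exists U : set G, [/\ is_subgroup U, open U & U `<=` A]
    & forall N : set G, is_normal_in [set: G] N -> open N ->
        has_p_power_index p [set: G] N].

Definition is_pro_p_pushout (p : nat) (A G1 G2 P : topologicalGroupType)
    (a1 : {hom A -> G1}) (a2 : {hom A -> G2})
    (i1 : {hom G1 -> P}) (i2 : {hom G2 -> P}) : Prop :=
  [/\ is_pro_p p P, continuous i1, continuous i2, i1 \o a1 =1 i2 \o a2 &
   forall (T : topologicalGroupType) (f1 : {hom G1 -> T}) (f2 : {hom G2 -> T}),
     is_pro_p p T -> continuous f1 -> continuous f2 -> f1 \o a1 =1 f2 \o a2 ->
   exists f : {hom P -> T},
     [/\ continuous f, f \o i1 =1 f1, f \o i2 =1 f2 &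
      forall g : {hom P -> T}, continuous g ->
        g \o i1 =1 f1 -> g \o i2 =1 f2 -> g =1 f]].

Definition is_topological_isomorphism (G H : topologicalGroupType)
    (f : {hom G -> H}) : Prop :=
  continuous f /\
  exists g : H -> G, [/\ cancel f g, cancel g f & continuous g].

Section Cosets.
Context {G : groupType}.
Implicit Types (N : set G) (x y : G).

Lemma left_cosetP N x y : left_coset x N y <-> N (x^-1 * y).
Proof.
split=> [[u Nu <-]|Ny]; first by rewrite mulKg.
by exists (x^-1 * y) => //; rewrite mulVKg.
Qed.

Variable N : set G.
Hypothesis nN : is_normal_in [set: G] N.

Let N1 : N 1. Proof. by case: nN => -[]. Qed.
Let NM x y : N x -> N y -> N (x * y). Proof. by case: nN => -[] _ + _ _ _; apply. Qed.
Let NV x : N x -> N x^-1. Proof. by case: nN => -[] _ _ + _ _; apply. Qed.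
Let NJ x u : N u -> N (u ^ x). Proof. by case: nN => _ _; apply. Qed.

Lemma left_coset1 : left_coset 1 N = N.
Proof. by apply/seteqP; split=> x; rewrite left_cosetP invg1 mul1g. Qed.

Lemma left_coset_refl x : left_coset x N x.
Proof. by apply/left_cosetP; rewrite mulVg. Qed.

Lemma left_coset_eqP x y : left_coset x N = left_coset y N <-> N (x^-1 * y).
Proof.
split=> [e|Nxy]; first by apply/left_cosetP; rewrite e; exact: left_coset_refl.
apply/seteqP; split=> z; rewrite !left_cosetP => Nz.
  have -> : y^-1 * z = (x^-1 * y)^-1 * (x^-1 * z).
    by rewrite invgM invgK -mulgA mulVKg.
  by apply: NM => //; exact: NV.
have -> : x^-1 * z = (x^-1 * y) * (y^-1 * z) by rewrite -mulgA mulVKg.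
exact: NM.
Qed.

Lemma left_cosetM x y :
  [set a * b | a in left_coset x N & b in left_coset y N] =
  left_coset (x * y) N.
Proof.
apply/seteqP; split=> [_ [a /left_cosetP Na [b /left_cosetP Nb <-]]|z].
  apply/left_cosetP.
  have -> : (x * y)^-1 * (a * b) = ((x^-1 * a) ^ y) * (y^-1 * b).
    by rewrite conjgE invgM !mulgA mulgK.
  by apply: NM => //; exact: NJ.
move/left_cosetP => Nz; exists x; first exact: left_coset_refl.
exists (x^-1 * z); last by rewrite mulVKg.
by apply/left_cosetP; rewrite mulgA -invgM.
Qed.

Lemma left_cosetV x : [set a^-1 | a in left_coset x N] = left_coset x^-1 N.
Proof.
apply/seteqP; split=> [_ [a /left_cosetP Na <-]|z /left_cosetP Nz].
  apply/left_cosetP; rewrite invgK.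
  have -> : x * a^-1 = ((x^-1 * a)^-1) ^ x^-1.
    by rewrite conjgE invgM !invgK -!mulgA mulgV mulg1.
  by apply: NJ; apply: NV.
exists z^-1; last by rewrite invgK.
apply/left_cosetP; rewrite invgK in Nz.
have -> : x^-1 * z^-1 = ((x * z)^-1) ^ x.
  by rewrite conjgE invgM -mulgA mulVg mulg1.
by apply: NJ; apply: NV.
Qed.

End Cosets.

Section FiniteIndex.
Import fingroup.fingroup.

Lemma finite_quotient (G : groupType) (N : set G) (n : nat) :
    is_normal_in [set: G] N ->
    [set left_coset x N | x in [set: G]] #= `I_n ->
  exists (Q : finGroupType) (q : G -> Q),
    [/\ #|[set: Q]%SET| = n, {morph q : x y / x * y},
        forall u, exists x, q x = u &
        forall x y, q x = q y <-> left_coset x N = left_coset y N].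
Proof.
move=> nN /card_set_bijP[c [cI cinj csurj]].
have cP x : (c (left_coset x N) < n)%N by apply: cI; exists x.
pose q x : 'I_n := Ordinal (cP x).
have qE x y : q x = q y <-> left_coset x N = left_coset y N.
  split=> [[e]|e]; last by apply: val_inj; rewrite /= e.
  by apply: cinj => //; apply/mem_set; [exists x|exists y].
have qsurj (u : 'I_n) : exists x, q x = u.
  have [_ [x _ <-] e] := csurj u (ltn_ord u).
  by exists x; apply: val_inj.
have [r rK] : exists r : 'I_n -> G, forall u, q (r u) = u.
  by have [r] := choice qsurj; exists r.
pose mul u v := q (r u * r v).
have qM x y : q (x * y) = mul (q x) (q y).
  by apply/qE; rewrite -!(left_cosetM nN); congr image2; apply/esym/qE/rK.
pose inv u := q (r u)^-1.
have mulA : associative mul.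
  by move=> u v w; rewrite -[u]rK -[v]rK -[w]rK -!qM mulgA.
have mul1 : left_id (q 1) mul by move=> u; rewrite -[u]rK -qM mul1g.
have mulV : left_inverse (q 1) inv mul.
  by move=> u; rewrite -{2}[u]rK -qM mulVg.
pose Q : finGroupType := HB.pack (ordinal n) (Finite_isGroup.Build (ordinal n) mulA mul1 mulV).
exists Q, q; split => //.
by rewrite cardsT card_ord.
Qed.

Lemma p_normal_preimage (p : nat) (G H : groupType) (f : {hom G -> H})
    (N : set H) :
  p_normal p [set: H] N -> p_normal p [set: G] (f @^-1` N).
Proof.
move=> [nN [n pn iN]]; have [[N1 NM NV] _ NJ] := nN.
have nf : is_normal_in [set: G] (f @^-1` N).
  split=> //; last by move=> x u _ Nu; rewrite /= gmulfJ; exact: NJ.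
  split=> [|x y Nx Ny|x Nx]; rewrite /= ?gmulf1 ?gmulfM ?gmulfV //.
    exact: NM.
  exact: NV.
split=> //.
have [Q [q [cQ qM qsurj qE]]] := finite_quotient nN iN.
pose B := [set u : Q | `[< exists x, q (f x) = u >]]%SET.
have gB : group_set B.
  have q1 : q 1 = 1%g by apply: (@mulgI _ (q 1)); rewrite -qM !mulg1.
  apply/group_setP; split.
    by rewrite inE; apply/asboolP; exists 1; rewrite gmulf1.
  move=> u v; rewrite !inE => /asboolP[x <-] /asboolP[y <-].
  by apply/asboolP; exists (x * y); rewrite gmulfM qM.
exists #|B|.
  have dB : #|Group gB| %| #|[group of [set: Q]%SET]|.
    by apply: cardSg; exact: finset.subsetT.
  by rewrite /= cQ in dB; exact: pnat_dvd pn.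
have cfE x y : left_coset x (f @^-1` N) = left_coset y (f @^-1` N) <->
    q (f x) = q (f y).
  by rewrite qE (left_coset_eqP nN) (left_coset_eqP nf) /= gmulfM gmulfV.
pose s (u : Q) : G := xget 1 [set x | q (f x) = u].
have sK u : u \in B -> q (f (s u)) = u.
  rewrite inE => /asboolP[x xu].
  exact: (@xgetPex _ 1 [set x | q (f x) = u]) (ex_intro _ x xu).
rewrite card_eq_sym; apply/card_set_bijP.
exists (fun i => left_coset (s (nth (q 1) (enum B) i)) (f @^-1` N)).
have nthB i : (i < #|B|)%N -> nth (q 1) (enum B) i \in B.
  by move=> lti; rewrite -mem_enum mem_nth // -cardE.
split=> [i /= lti|i j /set_mem /= lti /set_mem /= ltj /cfE|_ [x _ <-]].
- by eexists.
- rewrite !sK ?nthB // => /eqP.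
  by rewrite nth_uniq ?enum_uniq -?cardE // => /eqP.
- have Bx : q (f x) \in B by rewrite inE; apply/asboolP; exists x.
  exists (index (q (f x)) (enum B)); first by rewrite /= cardE index_mem mem_enum.
  by apply/cfE; rewrite nth_index ?mem_enum // sK.
Qed.

End FiniteIndex.

(* The inverse limit of the quotients G / N over the normal subgroups N of
   p-power index, in the product of the discrete spaces G / N. An element of
   G / N is represented by the corresponding coset, as a subset of G; the
   transition map G / M -> G / N, for M included in N, sends a coset of M to
   the coset of N that contains it. *)

Section Completion.
Variables (p : nat) (G : groupType).

Definition quotient_index : Type := set_type (p_normal p [set: G]).

Definition quotient_product : topologicalType :=
  prod_topology (fun _ : quotient_index => discrete_topology (set G)).

Definition coherent : set quotient_product :=
  [set x | (forall N, exists g, x N = left_coset g (val N)) /\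
           (forall M N, val M `<=` val N -> x M `<=` x N)].

Definition pro_p_completion : Type := set_type coherent.

HB.instance Definition _ := Topological.on pro_p_completion.

Implicit Types (x y : pro_p_completion) (M N : quotient_index).

Definition component x N : set G := val x N.

Lemma quotient_index_normal N : is_normal_in [set: G] (val N).
Proof. by have [] := set_valP N. Qed.
Let nN := quotient_index_normal.

Lemma component_coset x N : exists g, component x N = left_coset g (val N).
Proof. by have [] := set_valP x. Qed.

Lemma componentS x M N : val M `<=` val N -> component x M `<=` component x N.
Proof. by have [_] := set_valP x; apply. Qed.

Lemma completion_eq x y : component x =1 component y -> x = y.
Proof. by move=> e; apply: val_inj; apply: functional_extensionality_dep. Qed.

Definition limit_one : quotient_product := fun N => val N.
Definition limit_mul x y : quotient_product :=
  fun N => [set a * b | a in component x N & b in component y N].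
Definition limit_inv x : quotient_product :=
  fun N => [set a^-1 | a in component x N].
Definition limit_principal (g : G) : quotient_product := fun N => left_coset g (val N).

Lemma one_coherent : limit_one \in coherent.
Proof.
apply/mem_set; split=> // N; exists 1.
by rewrite (left_coset1 (val N)).
Qed.

Lemma mul_coherent x y : limit_mul x y \in coherent.
Proof.
apply/mem_set; split=> [N|M N sMN _ [a xa [b yb <-]]].
  have [[g eg] [h eh]] := (component_coset x N, component_coset y N).
  by exists (g * h); rewrite -(left_cosetM (nN N)) -eg -eh.
exists a; first exact: componentS xa.
by exists b; first exact: componentS yb.
Qed.

Lemma inv_coherent x : limit_inv x \in coherent.
Proof.
apply/mem_set; split=> [N|M N sMN _ [a xa <-]].
  have [g eg] := component_coset x N.
  by exists g^-1; rewrite -(left_cosetV (nN N)) -eg.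
by exists a => //; exact: componentS xa.
Qed.

Lemma principal_coherent g : limit_principal g \in coherent.
Proof.
apply/mem_set; split=> [N|M N sMN z]; first by exists g.
by move=> /left_cosetP Mz; apply/left_cosetP/sMN.
Qed.

Definition completion_one : pro_p_completion := SigSub one_coherent.
Definition completion_mul x y : pro_p_completion := SigSub (mul_coherent x y).
Definition completion_inv x : pro_p_completion := SigSub (inv_coherent x).

Lemma component_one N : component completion_one N = left_coset 1 (val N).
Proof. by rewrite left_coset1. Qed.

Lemma component_mul x y N g h :
  component x N = left_coset g (val N) -> component y N = left_coset h (val N) ->
  component (completion_mul x y) N = left_coset (g * h) (val N).
Proof. by rewrite -(left_cosetM (nN N)) => <- <-. Qed.

Lemma component_inv x N g :
  component x N = left_coset g (val N) ->
  component (completion_inv x) N = left_coset g^-1 (val N).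
Proof. by rewrite -(left_cosetV (nN N)) => <-. Qed.

Fact completion_mulA : associative completion_mul.
Proof.
move=> x y z; apply: completion_eq => N.
have [[a ea] [b eb]] := (component_coset x N, component_coset y N).
have [c ec] := component_coset z N.
rewrite (component_mul ea (component_mul eb ec)).
by rewrite (component_mul (component_mul ea eb) ec) mulgA.
Qed.

Fact completion_mul1g : left_id completion_one completion_mul.
Proof.
move=> x; apply: completion_eq => N; have [a ea] := component_coset x N.
by rewrite (component_mul (component_one N) ea) mul1g.
Qed.

Fact completion_mulg1 : right_id completion_one completion_mul.
Proof.
move=> x; apply: completion_eq => N; have [a ea] := component_coset x N.
by rewrite (component_mul ea (component_one N)) mulg1.
Qed.

Fact completion_mulVg : left_inverse completion_one completion_inv completion_mul.
Proof.
move=> x; apply: completion_eq => N; have [a ea] := component_coset x N.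
by rewrite (component_mul (component_inv ea) ea) mulVg component_one.
Qed.

Fact completion_mulgV : right_inverse completion_one completion_inv completion_mul.
Proof.
move=> x; apply: completion_eq => N; have [a ea] := component_coset x N.
by rewrite (component_mul ea (component_inv ea)) mulgV component_one.
Qed.

HB.instance Definition _ := isGroup.Build pro_p_completion
  completion_mulA completion_mul1g completion_mulg1
  completion_mulVg completion_mulgV.

Lemma component_continuous N :
  continuous (fun x => component x N : discrete_topology (set G)).
Proof.
move=> x; apply: (@continuous_comp _ _ _
  (val : pro_p_completion -> quotient_product) (fun f => f N)).
  exact: initial_continuous.
exact: (@proj_continuous quotient_index
  (fun _ => discrete_topology (set G)) N).
Qed.

Lemma component_near x N : \forall y \near x, component y N = component x N.
Proof. exact: (component_continuous (discrete_set1 _)). Qed.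

Lemma completion_continuousP (T : topologicalType) (f : T -> pro_p_completion) :
  (forall N t, \forall s \near t, component (f s) N = component (f t) N) ->
  continuous f.
Proof.
move=> fN; apply: continuous_comp_initial => t.
apply/cvg_sup => N U [V [[W oW <-] /= Wt]] /filterS; apply.
apply: filterS (fN N t) => s e.
by rewrite /= -[set_val _ _]/(component (f s) N) e.
Qed.

Fact completion_mul_continuous :
  continuous (fun xy : pro_p_completion * pro_p_completion => xy.1 * xy.2).
Proof.
apply: completion_continuousP => N [x y].
exists ([set x' | component x' N = component x N],
        [set y' | component y' N = component y N]).
  by split; exact: component_near.
move=> [x' y'] [/= ex ey].
have [[a ea] [b eb]] := (component_coset x N, component_coset y N).
by rewrite (component_mul ea eb); apply: component_mul; rewrite ?ex ?ey.
Qed.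

Fact completion_inv_continuous : continuous (fun x : pro_p_completion => x^-1).
Proof.
apply: completion_continuousP => N x.
apply: filterS (component_near x N) => x' /= ex.
have [a ea] := component_coset x N.
by rewrite (component_inv ea); apply: component_inv; rewrite ex.
Qed.

HB.instance Definition _ := isTopologicalGroup.Build pro_p_completion
  completion_mul_continuous completion_inv_continuous.

Definition completion_unit (g : G) : pro_p_completion := SigSub (principal_coherent g).

Fact completion_unit_monoid_morphism : monoid_morphism completion_unit.
Proof.
split=> [|g h]; apply: completion_eq => N; first by rewrite component_one.
by rewrite (@component_mul _ _ _ g h).
Qed.

HB.instance Definition _ := isUMagmaMorphism.Build G pro_p_completion
  completion_unit completion_unit_monoid_morphism.

End Completion.
Arguments completion_unit p {G} g.

Section CompletionMap.
Variables (p : nat) (G H : groupType) (f : {hom G -> H}).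
Implicit Types (x y : pro_p_completion p G) (N : quotient_index p H).

Definition preimage_index N : quotient_index p G :=
  SigSub (mem_set (p_normal_preimage f (set_valP N))).

(* The component at N is the image under G / f^-1(N) -> H / N of the
   component at f^-1(N): the coset of N containing f(g), for any g in the
   latter. *)
Definition limit_map x : quotient_product p H :=
  fun N => \bigcup_(g in component x (preimage_index N)) left_coset (f g) (val N).

Lemma limit_mapE x N g : component x (preimage_index N) g ->
  limit_map x N = left_coset (f g) (val N).
Proof.
have nN := quotient_index_normal N.
have [a ea] := component_coset x (preimage_index N).
rewrite /limit_map ea => /left_cosetP /= Nag.
apply/seteqP; split=> [h [b /left_cosetP /= Nab]|h Nh]; last first.
  by exists g => //; apply/left_cosetP.
suff -> : left_coset (f b) (val N) = left_coset (f g) (val N) by [].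
transitivity (left_coset (f a) (val N)).
  by apply/esym/(left_coset_eqP nN); move: Nab; rewrite gmulfM gmulfV.
by apply/(left_coset_eqP nN); move: Nag; rewrite gmulfM gmulfV.
Qed.

Lemma component_inhabited x M : exists g, component x M g.
Proof.
have [g ->] := component_coset x M.
by exists g; apply: left_coset_refl; exact: quotient_index_normal.
Qed.

Lemma map_coherent x : limit_map x \in @coherent p H.
Proof.
apply/mem_set; split=> [N|M N sMN].
  have [g xg] := component_inhabited x (preimage_index N).
  by exists (f g); exact: limit_mapE.
have [g xg] := component_inhabited x (preimage_index M).
have sMN' : val (preimage_index M) `<=` val (preimage_index N).
  by move=> u; exact: sMN.
rewrite (limit_mapE xg) (limit_mapE (componentS sMN' xg)).
by move=> h /left_cosetP Mh; apply/left_cosetP/sMN.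
Qed.

Definition completion_map x : pro_p_completion p H := SigSub (map_coherent x).

Lemma component_map x N g : component x (preimage_index N) g ->
  component (completion_map x) N = left_coset (f g) (val N).
Proof. exact: limit_mapE. Qed.

Lemma completion_map_unit g :
  completion_map (completion_unit p g) = completion_unit p (f g).
Proof.
apply: completion_eq => N; apply: component_map.
by apply: left_coset_refl; exact: quotient_index_normal.
Qed.

Fact completion_map_monoid_morphism : monoid_morphism completion_map.
Proof.
split=> [|x y].
  have <- : completion_unit p (1 : G) = 1 by exact: gmulf1.
  by rewrite completion_map_unit !gmulf1.
apply: completion_eq => N.
have [g xg] := component_inhabited x (preimage_index N).
have [h yh] := component_inhabited y (preimage_index N).
rewrite (component_mul (component_map xg) (component_map yh)) -gmulfM.
by apply: component_map; exists g => //; exists h.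
Qed.

HB.instance Definition _ := isUMagmaMorphism.Build
  (pro_p_completion p G) (pro_p_completion p H)
  completion_map completion_map_monoid_morphism.

Lemma completion_map_continuous : continuous completion_map.
Proof.
apply: completion_continuousP => N x.
apply: filterS (component_near x (preimage_index N)) => y /= exy.
have [g xg] := component_inhabited x (preimage_index N).
by rewrite (component_map xg); apply: component_map; rewrite exy.
Qed.

End CompletionMap.
Arguments completion_map p {G H} f x.

(* Pro-p pushouts are unique up to isomorphism, so asserting the properties of
   one of them amounts to asserting them of the amalgam. *)
Definition exact_pro_p_entrance (p : nat) (K H1 H2 Gamma : groupType)
    (k1 : {hom K -> H1}) (k2 : {hom K -> H2})
    (j1 : {hom H1 -> Gamma}) (j2 : {hom H2 -> Gamma}) : Prop :=
  [/\ injective (completion_map p k1), injective (completion_map p k2) &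
   exists (P : topologicalGroupType)
     (i1 : {hom pro_p_completion p H1 -> P})
     (i2 : {hom pro_p_completion p H2 -> P}),
   [/\ is_pro_p_pushout p (completion_map p k1) (completion_map p k2) i1 i2,
       injective i1, injective i2 &
       exists f : {hom P -> pro_p_completion p Gamma},
         [/\ f \o i1 =1 completion_map p j1, f \o i2 =1 completion_map p j2 &
             is_topological_isomorphism f]]].

(* Main.v *)
From HB Require Import structures.
Require Import Defs.
From mathcomp Require Import all_boot all_classical topology.
From mathcomp Require fingroup quotient ssralg zmodp.
Import fingroup.FinGroup.Exports.

(** The two implications rest on one dictionary: for a homomorphism [f : G -> H],
injectivity of the induced map of pro-p completions makes [range f] p-embedded
in [H] (lemma [p_embedded_of_completion_map_inj], a compactness argument), and
the converse holds when [f] itself is injective ([completion_map_inj]).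

(a) implies (b): a proper pushout isomorphic to the completion of [Gamma] makes
both [completion_map p j1] and [completion_map p j2] injective, and the
injectivity of the maps out of the completion of [K] is part of (a).

(b) implies (a): the completion functor turns the amalgam of abstract groups into the pro-p pushout of the completions
([completion_pushout]). Indeed a pair of continuous homomorphisms into a pro-p
group [T] restricts along the units to a pair of abstract homomorphisms, which
the universal property of [Gamma] glues, and a homomorphism from an abstract
group to a pro-p group extends to the completion ([completion_extension]). So
the completion of [Gamma] serves as the pushout, with the identity as
comparison isomorphism, and only injectivity is left. The dictionary gives it,
once the factors are known to embed in their amalgam. The latter is obtained
without normal forms ([amalgam_inj]): [H1] and [H2] both act on [H1 * H2], freely
and with the same restriction to [K].

The closures of the images of [H1] and [H2] are the images of the completions.
Suppose that a point [z] of both is not in the closure of the image of [K]. In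
some finite p-quotient [Q] of [Gamma], the image of [z] avoids the image [B] of
[K]. The p-group [Q] has two homomorphisms [s], [t] to a common finite p-group
that agree on [B] and have [s x <> t y] unless [x = y] is in [B]
([range_equalizer_p_group]): for [M] the module of functions from [Q] to
the integers mod p, with [Q] acting by translations, [s] is the inclusion of [Q]
in the semidirect product of [M] and [Q], and [t] is its conjugate by the
indicator function of [B], an element of [M] whose stabiliser is [B].
Composing [s] with [H1 -> Q] and [t] with [H2 -> Q] gives two maps that agree on
[K], hence a map out of the pushout; it would send the one point [z], seen from [H1] and from [H2], to two different
elements. *)

Set Implicit Arguments.
Unset Strict Implicit.
Unset Printing Implicit Defensive.

Local Open Scope classical_set_scope.
Local Open Scope card_scope.
Local Open Scope group_scope.

(** * Normal subgroups of p-power index *)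

Section PNormal.
Import fingroup.fingroup quotient.

Lemma p_normal_kernel (p : nat) (G : groupType) (Q : finGroupType) (q : G -> Q) :
    p.-nat #|Q| -> {morph q : x y / x * y} ->
  p_normal p [set: G] [set x | q x = 1].
Proof.
move=> pQ qM.
have q1 : q 1 = 1 by apply: (@mulgI _ (q 1)); rewrite -qM !mulg1.
pose f : {hom G -> Q} := HB.pack q (isUMagmaMorphism.Build G Q q (conj q1 qM)).
apply: (@p_normal_preimage p G Q f [set 1]).
split.
  split=> //; last by move=> x u _ /= ->; rewrite conj1g.
  split=> //= [x y -> ->|x ->]; first by rewrite mulg1.
  by rewrite invg1.
exists #|Q| => //.
rewrite card_eq_sym; apply/card_set_bijP.
(* The cosets of the trivial subgroup are the singletons. *)
exists (fun i => left_coset (nth 1 (enum Q) i) [set 1]).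
split=> [i _|i j /set_mem /= li /set_mem /= lj e|_ [x _ <-]].
- by eexists.
- have : left_coset (nth 1 (enum Q) j) [set 1] (nth 1 (enum Q) i).
    by rewrite -e; apply/left_cosetP; rewrite mulVg.
  move/left_cosetP/eqP; rewrite -eq_mulVg1 eq_sym nth_uniq ?enum_uniq -?cardE //.
  by move/eqP.
- exists (index x (enum Q)); first by rewrite /= cardE index_mem mem_enum.
  by rewrite nth_index // mem_enum.
Qed.

Lemma p_normal_quotient (p : nat) (G : groupType) (N : set G) :
    p_normal p [set: G] N ->
  exists (Q : finGroupType) (q : {hom G -> Q}),
    [/\ p.-nat #|Q|, forall u, exists x, q x = u &
        forall x, q x = 1 <-> N x].
Proof.
move=> [nN [n pn /(finite_quotient nN)[Q [q [cQ qM qsurj qE]]]]].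
have q1 : q 1 = 1 by apply: (@mulgI _ (q 1)); rewrite -qM !mulg1.
pose f : {hom G -> Q} := HB.pack q (isUMagmaMorphism.Build G Q q (conj q1 qM)).
exists Q, f; split=> //=; first by rewrite -cardsT cQ.
move=> x; rewrite -q1.
have := qE 1 x; rewrite (left_coset_eqP nN) invg1 mul1g => <-.
by split=> ->.
Qed.

Lemma p_normalT (p : nat) (G : groupType) : p_normal p [set: G] [set: G].
Proof.
split; first by [].
exists 1%N => //; rewrite card_eq_sym; apply/card_set_bijP.
exists (fun=> [set: G]); split=> [i _|i j|_ [x _ <-]].
- by exists 1 => //; rewrite left_coset1.
- by move=> /set_mem + /set_mem; case: i j => [|i] [|j].
- by exists 0%N => //; apply/seteqP; split=> // y _; apply/left_cosetP.
Qed.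

Lemma p_normalI (p : nat) (G : groupType) (M N : set G) :
  p_normal p [set: G] M -> p_normal p [set: G] N ->
  p_normal p [set: G] (M `&` N).
Proof.
move=> /p_normal_quotient[Q [q [pQ _ qE]]].
move=> /p_normal_quotient[R [r [pR _ rE]]].
pose QR : finGroupType :=
  HB.pack (Q * R)%type (Group.on (Q * R)%type) (Finite.on (Q * R)%type).
(* [M `&` N] is the kernel of the map to the product of the two quotients. *)
have -> : M `&` N = [set x | (q x, r x) = 1 :> QR].
  apply/seteqP; split=> x /=; first by move=> [/qE -> /rE ->].
  by move=> [/qE ? /rE ?].
apply: p_normal_kernel; first by rewrite card_prod pnatM pQ.
by move=> x y; rewrite !gmulfM.
Qed.

(** The image [B] of [N] in the finite quotient [G / M] is normal, and [N] is the
kernel of the map from [G] to [(G / M) / B]. *)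
Lemma p_normalS (p : nat) (G : groupType) (M N : set G) :
  p_normal p [set: G] M -> is_normal_in [set: G] N -> M `<=` N ->
  p_normal p [set: G] N.
Proof.
move=> /p_normal_quotient[Q [q [pQ qsurj qE]]] [[N1 NM NV] _ NJ] sMN.
pose B := [set u : Q | `[< exists2 x, N x & q x = u >]]%SET.
have qB x : (q x \in B) <-> N x.
  rewrite inE; split=> [/asboolP[y Ny exy]|Nx]; last by apply/asboolP; exists x.
  have : N (y * (y^-1 * x)).
    by apply: NM => //; apply/sMN/qE; rewrite gmulfM gmulfV exy mulVg.
  by rewrite mulVKg.
have gB : group_set B.
  apply/group_setP; split; first by rewrite -(gmulf1 (s := q)); apply/qB.
  move=> u v; have [[x <-] [y <-]] := (qsurj u, qsurj v).
  by rewrite -gmulfM => /qB Nx /qB Ny; apply/qB/NM.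
pose H := Group gB.
have nH u : u \in 'N(H).
  rewrite inE; apply/fintype.subsetP => _ /imsetP[v Hv ->].
  have [[x <-] [y ey]] := (qsurj u, qsurj v); rewrite -ey in Hv *.
  by rewrite conjgE -gmulfV -!gmulfM; apply/qB; have /qB := Hv; exact: NJ.
have nH' : H <| [set: Q]%SET.
  by apply/andP; split; [exact: finset.subsetT|apply/fintype.subsetP].
have -> : N = [set x | coset H (q x) = 1].
  apply/seteqP; split=> x /=; first by move=> /qB; exact: coset_id.
  by move=> /(coset_idr (nH _)) /qB.
apply: p_normal_kernel => [|x y]; last by rewrite gmulfM morphism.morphM.
apply: pnat_dvd pQ; rewrite -!cardsT.
suff -> : [set: coset_of H]%SET = [set: Q]%SET / H by exact: dvdn_quotient.
apply/setP=> U; rewrite finset.in_setT; apply/esym/imsetP.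
exists (repr U); last exact/esym/coset_reprK.
by rewrite finset.inE nH finset.inE.
Qed.
End PNormal.

(** Since [f @^-1` U] contains the kernel of [f], taking images under [f] is a
bijection from its cosets to those of [U] in [range f]. *)
Lemma p_normal_range (p : nat) (G H : groupType) (f : {hom G -> H}) (U : set H) :
  U `<=` range f ->
  p_normal p (range f) U <-> p_normal p [set: G] (f @^-1` U).
Proof.
move=> sUf.
have cardE : [set left_coset y U | y in range f] #=
    [set left_coset x (f @^-1` U) | x in [set: G]].
  have -> : [set left_coset y U | y in range f] =
      image ^~ f @` [set left_coset x (f @^-1` U) | x in [set: G]].
    have fE x : f @` left_coset x (f @^-1` U) = left_coset (f x) U.
      apply/seteqP; split=> [_ [y /left_cosetP Uxy <-]|_ [u Uu <-]].
        by apply/left_cosetP; rewrite -gmulfV -gmulfM.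
      have [y _ fy] := sUf u Uu.
      by exists (x * y); [exists y; rewrite //= fy|rewrite gmulfM fy].
    apply/seteqP; split=> [_ [_ [x _ <-] <-]|_ [_ [x _ <-] <-]].
      by exists (left_coset x (f @^-1` U)); [exists x|rewrite fE].
    by rewrite fE; exists (f x) => //; exists x.
  apply: inj_card_eq => C D /set_mem[x _ <-] /set_mem[y _ <-] e.
  have sub a b : f @` left_coset a (f @^-1` U) = f @` left_coset b (f @^-1` U) ->
      left_coset a (f @^-1` U) `<=` left_coset b (f @^-1` U).
    move=> eab z az.
    have : (f @` left_coset b (f @^-1` U)) (f z) by rewrite -eab; exists z.
    move=> [t /left_cosetP /= Ubt ftz]; apply/left_cosetP.
    by rewrite /= gmulfM -ftz -gmulfM.
  by apply/seteqP; split; apply: sub.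
have indexE : has_p_power_index p (range f) U <->
    has_p_power_index p [set: G] (f @^-1` U).
  split=> -[n pn cn]; exists n => //; apply: card_eq_trans cn => //.
  by rewrite card_eq_sym.
split=> -[[[U1 UM UV] sU UJ] /indexE iU]; split=> //; split=> //.
- split=> [|x y|x] /=; rewrite ?gmulf1 ?gmulfM ?gmulfV //; first exact: UM.
  exact: UV.
- by move=> x u _ Uu; rewrite /= gmulfJ; apply: UJ => //; exists x.
- split; first by move: U1; rewrite /= gmulf1.
  - move=> x y Ux Uy; have [[a _ fa] [b _ fb]] := (sUf _ Ux, sUf _ Uy).
    by rewrite -fa -fb -gmulfM; apply: UM; rewrite /= ?fa ?fb.
  - move=> x Ux; have [a _ fa] := sUf _ Ux.
    by rewrite -fa -gmulfV; apply: UV; rewrite /= fa.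
- move=> _ u [x _ <-] Uu; have [a _ fa] := sUf _ Uu.
  by rewrite -fa -gmulfJ; apply: UJ => //; rewrite /= fa.
Qed.

(** * The topology of the completion *)

Section CompletionTopology.
Variables (p : nat) (G : groupType).
Implicit Types (x y : pro_p_completion p G) (M N : quotient_index p G).

Lemma component_eq x N g :
  component x N g -> component x N = left_coset g (val N).
Proof.
have [a ->] := component_coset x N => /left_cosetP Nag.
exact/(left_coset_eqP (quotient_index_normal N)).
Qed.

Lemma component_finer M N x y : val M `<=` val N ->
  component x M = component y M -> component x N = component y N.
Proof.
move=> sMN e; have [g xg] := component_inhabited x M.
rewrite (component_eq (componentS sMN xg)).
by rewrite e in xg; rewrite (component_eq (componentS sMN xg)).
Qed.

Definition indexI M N : quotient_index p G :=
  SigSub (mem_set (p_normalI (set_valP M) (set_valP N))).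

(** A basic neighbourhood in the product topology constrains finitely many
components; the component at the intersection of their indices controls them
all. *)
Lemma completion_nbhsP x A :
  nbhs x A <-> exists N, [set y | component y N = component x N] `<=` A.
Proof.
split; last by move=> [N] /filterS; apply; exact: component_near.
pose B N := [set y | component y N = component x N].
have FB : Filter (filter_from setT B).
  apply: filter_fromT_filter; first by exists (SigSub (mem_set (p_normalT p G))).
  by move=> M N; exists (indexI M N) => y e; split; apply: component_finer e => ? [].
suff cB : filter_from setT B --> x by move=> /cB[N _]; exists N.
suff cv : (val @ filter_from setT B) --> (val x : quotient_product p G).
  move=> U [? [[W oW <-] /= Wx]] /filterS; apply.
  by apply: cv; exact: open_nbhs_nbhs.
apply/cvg_sup => N U [V [[W oW <-] /= Wt]] /filterS; apply.
by exists N => // y e; rewrite /= -[sval y N]/(component y N) e.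
Qed.

Lemma completion_hausdorff : hausdorff_space (pro_p_completion p G).
Proof.
move=> x y cxy; apply: completion_eq => N.
by have [z [<- <-]] := cxy _ _ (component_near x N) (component_near y N).
Qed.

(** An ultrafilter [F] chooses one of the finitely many cosets of each index; the
chosen cosets are coherent because sets in [F] meet, and they form the limit of
[F]. *)
Lemma completion_compact : compact [set: pro_p_completion p G].
Proof.
rewrite compact_ultra => F FU _.
have cP N : exists g, F [set x | component x N = left_coset g (val N)].
  have [_ [n _ cn]] := set_valP N.
  have fin : finite_set ([set left_coset g (val N) | g in [set: G]]
      : set (discrete_topology (set G))).
    by apply/finite_setP; exists n.
  pose h x : discrete_topology (set G) := component x N.
  have [] := finite_compact fin (F := fmap h F) _.
    rewrite /fmap /=; apply: (@filterS _ F _ setT) filterT => x _.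
    by have [g e] := component_coset x N; exists g.
  move=> C [[g _ <-] cC]; exists g.
  have [//|Fn] := in_ultra_setVsetC [set x | component x N = left_coset g (val N)] FU.
  have [D [/= + e]] := cC (~` [set left_coset g (val N)]) _ Fn (discrete_set1 _).
  by rewrite e.
have [c cF] := choice cP.
pose z : quotient_product p G := fun N => left_coset (c N) (val N).
have zP : z \in @coherent p G.
  apply/mem_set; split=> [N|M N sMN]; first by exists (c N).
  have [x [xM xN]] := filter_ex (filterI (cF M) (cF N)).
  by rewrite /z -xM -xN; exact: componentS.
exists (SigSub zP); split=> // A /completion_nbhsP[N] /filterS; apply.
exact: cF.
Qed.

Lemma completion_unit_dense x A :
  nbhs x A -> exists g, A (completion_unit p g).
Proof.
move=> /completion_nbhsP[N sNA]; have [g e] := component_coset x N.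
by exists g; apply: sNA.
Qed.

Definition component_kernel N : set (pro_p_completion p G) :=
  [set x | component x N = component 1 N].

Lemma component_kernel_open N : open (component_kernel N).
Proof.
rewrite openE => x xN; apply: filterS (component_near x N) => y e.
exact: etrans e xN.
Qed.

Lemma component_kernel_unit N g :
  component_kernel N (completion_unit p g) <-> val N g.
Proof.
have nN := quotient_index_normal N; have [[_ _ NV] _ _] := nN.
rewrite -[component_kernel N _]/(left_coset g (val N) = val N).
rewrite -{2}(left_coset1 (val N)) (left_coset_eqP nN) mulg1.
by split=> /NV; rewrite ?invgK.
Qed.

(** The kernel of the projection to the quotient by [N] is that of a map to a
finite p-group, obtained by evaluating the quotient map on any representative
[r x] of the component. *)
Lemma component_kernel_p_normal N :
  p_normal p [set: pro_p_completion p G] (component_kernel N).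
Proof.
have nN := quotient_index_normal N.
have [Q [q [pQ _ qE]]] := p_normal_quotient (set_valP N).
have [r rP] := choice (fun x => component_inhabited x N).
have qC x g : component x N g -> q (r x) = q g.
  move=> xg; have := rP x; rewrite (component_eq xg) => /left_cosetP /qE.
  rewrite gmulfM => e; apply: (@mulgI _ (q g^-1)); rewrite e -gmulfM mulVg.
  exact/esym/gmulf1.
have -> : component_kernel N = [set x | q (r x) = 1].
  have c1 : component (1 : pro_p_completion p G) N = left_coset 1 (val N).
    exact: component_one.
  apply/seteqP; split=> x /= e.
    rewrite -(gmulf1 (s := q)); apply: qC; rewrite e c1; exact: left_coset_refl.
  apply: etrans (component_eq (rP x)) _; rewrite -[RHS]/(component 1 N) c1.
  by apply/esym/(left_coset_eqP nN)/qE; rewrite invg1 mul1g.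
apply: (@p_normal_kernel p _ Q (q \o r)) => // x y /=.
by rewrite -gmulfM; apply: qC; exists (r x) => //; exists (r y).
Qed.

Lemma completion_is_pro_p : is_pro_p p (pro_p_completion p G).
Proof.
split; [exact: completion_compact|exact: completion_hausdorff| |].
  move=> A /completion_nbhsP[N sNA]; exists (component_kernel N).
  split=> //; last exact: component_kernel_open.
  by case: (component_kernel_p_normal N) => -[].
move=> N nN oN.
have /completion_nbhsP[M sMN] : nbhs 1 N.
  by apply: open_nbhs_nbhs; split=> //; case: nN => -[].
by have [] := p_normalS (component_kernel_p_normal M) nN sMN.
Qed.

End CompletionTopology.

(** * Extension of homomorphisms to the completion *)

(** The image of the unit is dense. *)
Lemma completion_continuous_eq (p : nat) (G : groupType) (T : topologicalType)
    (f g : pro_p_completion p G -> T) :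
  hausdorff_space T -> continuous f -> continuous g ->
  f \o completion_unit p =1 g \o completion_unit p -> f =1 g.
Proof.
move=> hT cf cg fg x; apply: hT => A B Af Bg.
have xA : nbhs x (f @^-1` A) by exact: cf.
have xB : nbhs x (g @^-1` B) by exact: cg.
have [h [Ah Bh]] := completion_unit_dense (filterI xA xB).
by exists (f (completion_unit p h)); split=> //; have /= -> := fg h.
Qed.

Section ProP.
Variable T : topologicalGroupType.

Lemma mulg_near (x y : T) A : nbhs (x * y) A ->
  exists2 B, nbhs x B & exists2 C, nbhs y C & forall b c, B b -> C c -> A (b * c).
Proof.
move=> /(@mulg_continuous T (x, y)) [[B C] [/= Bx Cy] sBC].
by exists B => //; exists C => // b c Bb Cc; exact: (sBC (b, c)).
Qed.

Lemma shift_from_one_near (x : T) A : nbhs 1 A -> \forall y \near x, A (x^-1 * y).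
Proof.
rewrite -{1}(mulVg x) => /mulg_near[B Bx [C Cx sBC]].
by apply: filterS Cx => c; apply: sBC; exact: nbhs_singleton.
Qed.

Lemma shift_to_one_near (x : T) A : nbhs x A -> \forall u \near (1 : T), A (x * u).
Proof.
rewrite -{1}(mulg1 x) => /mulg_near[B Bx [C C1 sBC]].
by apply: filterS C1 => c; apply: sBC; exact: nbhs_singleton.
Qed.

(** The core of [U] is open: conjugation sends [(x, 1)] to [1], hence a
neighbourhood of [(x, 1)] into [U], and finitely many such neighbourhoods cover
all [x]. *)
Lemma open_normal_core (U : set T) :
    compact [set: T] -> is_subgroup U -> open U ->
  exists N, [/\ is_normal_in [set: T] N, open N & N `<=` U].
Proof.
move=> /compact_near_coveringP cT [U1 UM UV] oU.
pose N := [set u : T | forall x : T, U (u ^ x)].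
have nN : is_normal_in [set: T] N.
  split=> //; last by move=> x u _ Nu y; rewrite -conjgM.
  split=> [x|u v Nu Nv x|u Nu x].
  - by rewrite conj1g.
  - by rewrite conjMg; apply: UM.
  - by rewrite conjVg; apply: UV.
have N1 : nbhs 1 N.
  suff UN : nbhs (1 : T) [set u | [set: T] `<=` (fun x => U (u ^ x))].
    by apply: filterS UN => u Nu x; exact: Nu.
  apply: (cT T (nbhs (1 : T)) (fun u x => U (u ^ x))) => x _.
  have U1' : nbhs (x^-1 * (1 * x)) U.
    by apply: open_nbhs_nbhs; split; rewrite // mul1g mulVg.
  have [B Bx [C Cx sBC]] := mulg_near U1'.
  have [D D1 [E Ex sDE]] := mulg_near Cx.
  exists (E `&` [set y | B y^-1], D) => /=.
    split=> //; apply: filterI => //; exact: (@invg_continuous T x).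
  by move=> [y u] [/= [Ey By] Du]; apply: sBC => //; apply: sDE.
exists N; split=> //; last by move=> u /(_ 1); rewrite conjg1.
rewrite openE => u Nu; apply: filterS (shift_from_one_near u N1) => v.
have [[_ NM _] _ _] := nN.
by move=> /(NM _ _ Nu); rewrite mulVKg.
Qed.

Variable p : nat.
Hypothesis proT : is_pro_p p T.

Lemma pro_p_base (A : set T) : nbhs 1 A ->
  exists N : quotient_index p T, open (val N) /\ val N `<=` A.
Proof.
have [cT _ base pN] := proT; move=> /base[U [sU oU sUA]].
have [N [nN oN sNU]] := open_normal_core cT sU oU.
exists (SigSub (mem_set (conj nN (pN N nN oN)) : N \in p_normal p [set: T])).
by split=> //=; apply: subset_trans sUA.
Qed.

(** The components of [x] at the open indices are closed cosets, directed by
inclusion; they have a common point because [T] is compact. *)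
Lemma pro_p_limit (x : pro_p_completion p T) :
  exists t, forall N, open (val N) -> component x N t.
Proof.
pose I := [set N : quotient_index p T | open (val N)].
pose F := filter_from I (component x).
have FF : ProperFilter F.
  apply: filter_from_proper => [|N _]; last exact: component_inhabited.
  apply: filter_from_filter.
    have [N [oN _]] := pro_p_base (@filterT _ (nbhs (1 : T)) _).
    by exists N.
  move=> M N oM oN; exists (indexI M N); first exact: openI.
  by move=> g xg; split; apply: componentS xg => ? [].
have [cT _ _ _] := proT.
have [t [_ ct]] := cT F FF filterT.
exists t => N oN; have [[N1 _ NV] _ _] := quotient_index_normal N.
have Nt := shift_from_one_near t (open_nbhs_nbhs (conj oN N1)).
have [u [xu Ntu]] := ct _ _ (ex_intro2 _ _ N oN (fun=> id)) Nt.
rewrite (component_eq xu); apply/left_cosetP.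
by have := NV _ Ntu; rewrite invgM invgK.
Qed.

Lemma pro_p_limit_unique (x : pro_p_completion p T) s t :
  (forall N, open (val N) -> component x N s) ->
  (forall N, open (val N) -> component x N t) -> s = t.
Proof.
move=> xs xt; have [_ hT _ _] := proT.
apply: hT => A B As /nbhs_singleton Bt; exists t; split=> //.
have [N [oN sNA]] := pro_p_base (shift_to_one_near As).
have := xt N oN; rewrite (component_eq (xs N oN)) => /left_cosetP /sNA /=.
by rewrite mulVKg.
Qed.

(** A pro-p group is a retract of its completion as an abstract group: a point of
the completion is sent to the common point of its components at the open
indices. *)
Lemma pro_p_retraction :
  exists r : {hom pro_p_completion p T -> T},
    continuous r /\ r \o completion_unit p =1 id.
Proof.
have [r rP] := choice pro_p_limit.
have rM : {morph r : x y / x * y}.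
  move=> x y; apply: (@pro_p_limit_unique (x * y)); first exact: rP.
  by move=> N oN; exists (r x); [exact: rP|exists (r y); first exact: rP].
have rU t : r (completion_unit p t) = t.
  apply: pro_p_limit_unique (rP _) _ => N _.
  exact: (left_coset_refl (quotient_index_normal N)).
have r1 : r 1 = 1 by rewrite -[RHS]rU gmulf1.
pose f : {hom pro_p_completion p T -> T} :=
  HB.pack r (isUMagmaMorphism.Build _ _ r (conj r1 rM : monoid_morphism r)).
exists f; split=> // x A /shift_to_one_near Ar.
have [N [oN sNA]] := pro_p_base Ar.
apply: filterS (component_near x N) => y exy.
have : component x N (r y) by rewrite -exy; exact: rP.
rewrite (component_eq (rP x N oN)) => /left_cosetP /sNA /=.
by rewrite mulVKg.
Qed.
End ProP.

Lemma completion_extension (p : nat) (G : groupType) (T : topologicalGroupType)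
    (phi : {hom G -> T}) : is_pro_p p T ->
  exists f : {hom pro_p_completion p G -> T},
    continuous f /\ f \o completion_unit p =1 phi.
Proof.
move=> /pro_p_retraction[r [cr rU]].
exists (r \o completion_map p phi); split=> [x|g /=].
  by apply: continuous_comp; [exact: completion_map_continuous|exact: cr].
by rewrite completion_map_unit -[RHS]rU.
Qed.

(** * Factors of an amalgam *)

Section Symmetric.
Variable X : Type.

Record bijection := Bijection {
  bij_fun :> X -> X;
  bij_inv : X -> X;
  bij_funK : cancel bij_fun bij_inv;
  bij_invK : cancel bij_inv bij_fun }.

HB.instance Definition _ := gen_eqMixin bijection.
HB.instance Definition _ := gen_choiceMixin bijection.

Lemma bijection_eq (s t : bijection) : s =1 t -> s = t.
Proof.
case: s t => [f f' fK f'K] [g g' gK g'K] /= /funext efg.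
subst g; have e : f' = g' by apply/funext => x; rewrite -{1}(g'K x) fK.
by subst g'; congr Bijection; exact: Prop_irrelevance.
Qed.

Definition bijection_one := @Bijection id id (frefl _) (frefl _).
Definition bijection_mul s t :=
  Bijection (can_comp (bij_funK s) (bij_funK t)) (can_comp (bij_invK t) (bij_invK s)).
Definition bijection_inv s := Bijection (bij_invK s) (bij_funK s).

Fact bijection_mulA : associative bijection_mul.
Proof. by move=> s t u; exact: bijection_eq. Qed.
Fact bijection_mul1 : left_id bijection_one bijection_mul.
Proof. by move=> s; exact: bijection_eq. Qed.
Fact bijection_mulg1 : right_id bijection_one bijection_mul.
Proof. by move=> s; exact: bijection_eq. Qed.
Fact bijection_mulV : left_inverse bijection_one bijection_inv bijection_mul.
Proof. by move=> s; apply: bijection_eq => x /=; rewrite bij_funK. Qed.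
Fact bijection_mulgV : right_inverse bijection_one bijection_inv bijection_mul.
Proof. by move=> s; apply: bijection_eq => x /=; rewrite bij_invK. Qed.

HB.instance Definition _ := isGroup.Build bijection
  bijection_mulA bijection_mul1 bijection_mulg1 bijection_mulV bijection_mulgV.

End Symmetric.

(** Each [h] is the product of a part [c h] from [K] and a chosen representative
[a h] of the coset of [h]: as a [K]-set for left multiplication, [H] is free. *)
Lemma coset_splitting (K H : groupType) (k : {hom K -> H}) : injective k ->
  exists (c : H -> K) (a : H -> H), [/\ forall h, k (c h) * a h = h,
    forall x h, c (k x * h) = x * c h, forall x h, a (k x * h) = a h,
    forall h, c (a h) = 1 & forall h, a (a h) = a h].
Proof.
move=> kI; pose orb h := [set k x * h | x in [set: K]].
pose a h := xget 1 (orb h).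
have aM x h : a (k x * h) = a h.
  congr (xget 1 _); apply/seteqP; split=> [_ [y _ <-]|_ [y _ <-]].
    by exists (y * x) => //; rewrite gmulfM mulgA.
  by exists (y * x^-1) => //; rewrite gmulfM gmulfV -mulgA mulKg.
have /choice[c cP] h : exists x, k x * a h = h.
  have [x _ <-] : orb h (a h).
    by apply: (@xgetPex _ 1 (orb h)); exists h; exists 1; rewrite // gmulf1 mul1g.
  by exists x^-1; rewrite gmulfV mulKg.
have cM x h : c (k x * h) = x * c h.
  apply: kI; apply: (@mulIg _ (a h)).
  by rewrite -{1}(aM x h) cP gmulfM -mulgA cP.
exists c, a; split=> // h; last by rewrite -{2}(cP h) aM.
by apply: (@mulgI _ (c h)); rewrite -cM cP mulg1.
Qed.

(** [H1] acts on [H1 * H2], and [H2] on [H2 * H1], by left multiplication on the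
first factor. Writing [H1 = K * A] and [H2 = K * B] with [A] and [B] the coset
representatives, both are isomorphic, as [K]-sets, to [K] times a trivial
[K]-set in bijection with [K * A * B]. Transporting the second action along the
isomorphism that exchanges the [A] part and the [B] part, one gets two
homomorphisms to the symmetric group of [H1 * H2] that agree on [K]; the one
on [H1] is injective and, by the universal property, factors through [j1]. *)
Lemma amalgam_inj (K H1 H2 Gamma : groupType)
    (k1 : {hom K -> H1}) (k2 : {hom K -> H2})
    (j1 : {hom H1 -> Gamma}) (j2 : {hom H2 -> Gamma}) :
  is_amalgam k1 k2 j1 j2 -> injective j1.
Proof.
move=> [k1I k2I _ univ].
have [c1 [a1 [e1 c1M a1M c1a a1a]]] := coset_splitting k1I.
have [c2 [a2 [e2 c2M a2M c2a a2a]]] := coset_splitting k2I.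
pose X := (H1 * H2)%type.
pose swap (x : X) : H2 * H1 := (k2 (c1 x.1) * a2 x.2, k1 (c2 x.2) * a1 x.1).
pose swap' (y : H2 * H1) : X := (k1 (c2 y.1) * a1 y.2, k2 (c1 y.2) * a2 y.1).
have swapK : cancel swap swap'.
  move=> [x y]; rewrite /swap /swap' /=.
  by rewrite c1M c1a mulg1 c2M c2a mulg1 a1M a2M a1a a2a e1 e2.
have swap'K : cancel swap' swap.
  move=> [x y]; rewrite /swap /swap' /=.
  by rewrite c1M c1a mulg1 c2M c2a mulg1 a1M a2M a1a a2a e1 e2.
pose l1 (h : H1) (x : X) : X := (h * x.1, x.2).
have l1K h : cancel (l1 h) (l1 h^-1) by move=> [x y]; rewrite /l1 /= mulKg.
have l1K' h : cancel (l1 h^-1) (l1 h) by move=> [x y]; rewrite /l1 /= mulVKg.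
pose l2 (h : H2) (y : H2 * H1) := (h * y.1, y.2).
have l2K h : cancel (l2 h) (l2 h^-1) by move=> [y x]; rewrite /l2 /= mulKg.
have l2K' h : cancel (l2 h^-1) (l2 h) by move=> [y x]; rewrite /l2 /= mulVKg.
pose m2 (h : H2) (x : X) := swap' (l2 h (swap x)).
have m2K h : cancel (m2 h) (m2 h^-1).
  by move=> x; rewrite /m2 swap'K l2K swapK.
have m2K' h : cancel (m2 h^-1) (m2 h).
  by move=> x; rewrite /m2 swap'K l2K' swapK.
pose f1 h := Bijection (l1K h) (l1K' h).
pose f2 h := Bijection (m2K h) (m2K' h).
have f1M : monoid_morphism f1.
  split=> [|g h]; apply: bijection_eq => -[x y].
    by rewrite /= /l1 mul1g.
  by rewrite /= /l1 /= mulgA.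
have f2M : monoid_morphism f2.
  have l2M g h y : l2 (g * h) y = l2 g (l2 h y) by rewrite /l2 /= mulgA.
  have l21 y : l2 1 y = y by case: y => y x; rewrite /l2 /= mul1g.
  split=> [|g h]; apply: bijection_eq => x /=.
    by rewrite /m2 l21 swapK.
  by rewrite /m2 swap'K l2M.
pose F1 : {hom H1 -> bijection X} := HB.pack f1 (isUMagmaMorphism.Build _ _ f1 f1M).
pose F2 : {hom H2 -> bijection X} := HB.pack f2 (isUMagmaMorphism.Build _ _ f2 f2M).
have [x|F [FE _ _]] := univ _ F1 F2 _.
  apply: bijection_eq => -[y z]; rewrite /= /l1 /m2 /=.
  apply: (can_inj swapK); rewrite swap'K /swap /l2 /=.
  by rewrite c1M gmulfM mulgA a1M.
move=> g h e; have : F1 g = F1 h by rewrite -!FE /= e.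
by move=> /(congr1 (fun s : bijection X => (s (1, 1)).1)) /=; rewrite /l1 /= !mulg1.
Qed.

Lemma is_amalgam_sym (K H1 H2 Gamma : groupType)
    (k1 : {hom K -> H1}) (k2 : {hom K -> H2})
    (j1 : {hom H1 -> Gamma}) (j2 : {hom H2 -> Gamma}) :
  is_amalgam k1 k2 j1 j2 -> is_amalgam k2 k1 j2 j1.
Proof.
move=> [k1I k2I jk univ]; split=> // T f2 f1 fk.
have [|f [fj1 fj2 fu]] := univ T f1 f2; first exact: fsym.
by exists f; split=> // g gj2 gj1; exact: fu.
Qed.

(** * p-embedded images and injectivity on completions *)

Section MapInjective.
Variables (p : nat) (G H : groupType) (f : {hom G -> H}).

(** If [x] is in the kernel, then for each index [V] of [G] the component of [x] at
[V] is trivial: take an index [N] of [H] whose preimage is inside [V]; the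
component of [x] at that preimage maps to the trivial coset of [N]. *)
Lemma completion_map_inj :
  injective f -> p_embedded p (range f) -> injective (completion_map p f).
Proof.
move=> fI emb.
suff ker (x : pro_p_completion p G) : completion_map p f x = 1 -> x = 1.
  move=> x y e; apply: (@mulIg _ y^-1); rewrite mulgV; apply: ker.
  by rewrite gmulfM gmulfV /= e mulgV.
move=> fx1; apply: completion_eq => V.
have pV : p_normal p (range f) (f @` val V).
  apply/p_normal_range; first by move=> _ [y _ <-]; exists y.
  suff -> : f @^-1` (f @` val V) = val V by exact: set_valP.
  by apply/seteqP; split=> y; [move=> [z Vz /fI <-]|exists y].
have [N pN sNV] := emb _ pV; have [[[N1 _ NV] _ _] _] := pN.
pose i : quotient_index p H := SigSub (mem_set pN).
have [g xg] := component_inhabited x (preimage_index f i).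
have := component_map xg; rewrite fx1 => e.
have Ng : N (f g).
  have /left_cosetP : left_coset (f g) N 1 by rewrite -[left_coset _ _]e.
  by rewrite mulg1 => /NV; rewrite invgK.
have sub : val (preimage_index f i) `<=` val V.
  move=> y Ny; have [|z Vz /fI <- //] := sNV (f y).
  by split=> //; exists y.
rewrite (component_eq (componentS sub xg)).
have -> : component (1 : pro_p_completion p G) V = left_coset 1 (val V).
  exact: component_one.
apply/esym/(left_coset_eqP (quotient_index_normal V)); rewrite invg1 mul1g.
exact: sub.
Qed.

(** The points of the completion of [G] with a nontrivial component at the
preimage of [U] form a compact set, whose image [C] in the completion of [H] is
closed and, by injectivity, misses [1]. A basic neighbourhood of [1] that misses [C] is the
kernel at an index [N], and this [N] meets [range f] inside [U]. *)
Lemma p_embedded_of_completion_map_inj :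
  injective (completion_map p f) -> p_embedded p (range f).
Proof.
move=> fI U pU.
have sU : U `<=` range f by case: pU => -[].
pose V : quotient_index p G :=
  SigSub (mem_set ((p_normal_range p sU).1 pU)).
pose C := completion_map p f @` (~` component_kernel V).
have cC : compact C.
  apply: continuous_compact.
    by apply: continuous_subspaceT; exact: completion_map_continuous.
  apply: (@subclosed_compact _ _ setT) => //; last exact: completion_compact.
  by apply: open_closedC; exact: component_kernel_open.
have : nbhs 1 (~` C).
  apply: open_nbhs_nbhs; split.
    by apply: closed_openC; apply: compact_closed cC; exact: completion_hausdorff.
  move=> [x nx fx]; apply: nx.
  suff -> : x = 1 by [].
  by apply: fI; rewrite fx gmulf1.
move=> /completion_nbhsP[N sN]; exists (val N); first exact: set_valP.
move=> y [Ny [g _ fg]]; rewrite -{y}fg in Ny *.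
suff : component_kernel V (completion_unit p g) by move/component_kernel_unit.
apply: contrapT => kg.
have kN : component_kernel N (completion_unit p (f g)).
  exact: (component_kernel_unit N (f g)).2.
by apply: (sN _ kN); exists (completion_unit p g); rewrite // completion_map_unit.
Qed.

End MapInjective.

(** * A finite p-group separating the complement of a subgroup *)

Section Equalizer.
Import fingroup.fingroup ssralg zmodp GRing.Theory.

Section WreathProduct.
Variables (p : nat) (Q : finGroupType).

(** The regular wreath product of the integers mod [p] by [Q]; a named copy of the
pair type, since the latter carries the direct product structure. *)
Definition wreath : Type := ({ffun Q -> 'Z_p} * Q)%type.
HB.instance Definition _ := Finite.on wreath.

Implicit Types x y z : wreath.

Definition wreath_mul x y : wreath :=
  ([ffun w => x.1 w + y.1 (x.2^-1 * w)%g]%R, (x.2 * y.2)%g).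
Definition wreath_one : wreath := ([ffun=> 0%R], 1).
Definition wreath_inv x : wreath := ([ffun w => - x.1 (x.2 * w)%g]%R, x.2^-1).

Fact wreath_mulA : associative wreath_mul.
Proof.
move=> x y z; congr pair; last exact: mulgA.
by apply/ffunP => w; rewrite !ffunE /= addrA invMg mulgA.
Qed.

Fact wreath_mul1 : left_id wreath_one wreath_mul.
Proof.
move=> [u a]; congr pair; last exact: mul1g.
by apply/ffunP => w; rewrite !ffunE /= invg1 mul1g add0r.
Qed.

Fact wreath_mulV : left_inverse wreath_one wreath_inv wreath_mul.
Proof.
move=> [u a]; congr pair; last exact: mulVg.
by apply/ffunP => w; rewrite !ffunE /= invgK addNr.
Qed.

HB.instance Definition _ :=
  Finite_isGroup.Build wreath wreath_mulA wreath_mul1 wreath_mulV.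

Lemma card_wreath : (1 < p)%N -> #|{: wreath}| = (p ^ #|Q| * #|Q|)%N.
Proof. by move=> p1; rewrite card_prod card_ffun card_ord Zp_cast. Qed.

End WreathProduct.

(** With [chi] the indicator function of the subgroup [range h], seen as an element
of the base group of the wreath product, [t] is the conjugate by [chi] of the
inclusion [s] of [Q]. An element [y] of [Q] has [t y = s y] exactly when [chi] is
invariant under left translation by [y], that is, when [y] is in [range h]. *)
Lemma range_equalizer_p_group (p : nat) (K : groupType) (Q : finGroupType)
    (h : {hom K -> Q}) : prime p -> p.-nat #|Q| ->
  exists (T : finGroupType) (s t : {hom Q -> T}),
    [/\ p.-nat #|T|, injective s, s \o h =1 t \o h &
        forall x y, s x = t y -> x = y /\ range h x].
Proof.
move=> pp pQ; pose T : finGroupType := wreath p Q.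
pose chi (x : Q) : 'Z_p := (`[< range h x >]%:R)%R.
pose s0 (x : Q) : T := ([ffun=> 0%R], x).
pose t0 (x : Q) : T := ([ffun z => chi z - chi (x^-1 * z)%g]%R, x).
have sM : @monoid.monoid_morphism Q T s0.
  split=> // x y; congr pair.
  by apply/ffunP => w; rewrite !ffunE addr0.
have tM : @monoid.monoid_morphism Q T t0.
  split=> [|x y]; congr pair; apply/ffunP => w; rewrite !ffunE /=.
    by rewrite invg1 mul1g subrr.
  by rewrite addrA subrK invMg mulgA.
pose s : {hom Q -> T} := HB.pack s0 (isUMagmaMorphism.Build Q T s0 sM).
pose t : {hom Q -> T} := HB.pack t0 (isUMagmaMorphism.Build Q T t0 tM).
exists T, s, t; split.
- by rewrite card_wreath ?prime_gt1 // pnatM pQ andbT pnatX pnat_id.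
- by move=> x y [].
- move=> k; congr pair; apply/ffunP => w; rewrite !ffunE /chi.
  suff -> : range h ((h k)^-1 * w)%g = range h w by rewrite subrr.
  apply/propext; split=> [[x _ e]|[x _ <-]].
    by exists (k * x)%g => //; rewrite gmulfM e mulKVg.
  by exists (k^-1 * x)%g => //; rewrite gmulfM gmulfV.
- move=> x y [/ffunP e exy]; rewrite -{y}exy in e *; split=> //.
  (* Invariance at 1 reads 1 = chi (x^-1). *)
  have := e 1; rewrite !ffunE mulg1 /chi.
  have -> : `[< range h 1 >] by apply/asboolP; exists 1; rewrite ?gmulf1.
  case: asboolP => [[k _ hk] _|_ /eqP]; last by rewrite subr0 eq_sym oner_eq0.
  by exists k^-1 => //; rewrite gmulfV hk invgK.
Qed.
End Equalizer.

(** * Completion of an amalgam *)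

Section Functoriality.
Variables (p : nat) (K H1 H2 : groupType).

Lemma completion_map_comp_eq (L : groupType) (f1 : {hom K -> H1}) (f2 : {hom K -> H2})
    (g1 : {hom H1 -> L}) (g2 : {hom H2 -> L}) : g1 \o f1 =1 g2 \o f2 ->
  completion_map p g1 \o completion_map p f1 =1
  completion_map p g2 \o completion_map p f2.
Proof.
move=> e; apply: completion_continuous_eq => [|x|x|x /=].
- exact: completion_hausdorff.
- by apply: continuous_comp; exact: completion_map_continuous.
- by apply: continuous_comp; exact: completion_map_continuous.
- by rewrite !completion_map_unit [g1 _]e.
Qed.
End Functoriality.

Section Main.
Variables (p : nat) (K H1 H2 Gamma : groupType).
Variables (k1 : {hom K -> H1}) (k2 : {hom K -> H2}).
Variables (j1 : {hom H1 -> Gamma}) (j2 : {hom H2 -> Gamma}).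
Hypothesis amalg : is_amalgam k1 k2 j1 j2.

(** Completion is left adjoint to the inclusion of pro-p groups in groups, and left
adjoints preserve pushouts. *)
Lemma completion_pushout :
  is_pro_p_pushout p (completion_map p k1) (completion_map p k2)
    (completion_map p j1) (completion_map p j2).
Proof.
have [_ _ jk univ] := amalg; split.
- exact: completion_is_pro_p.
- exact: completion_map_continuous.
- exact: completion_map_continuous.
- exact: completion_map_comp_eq.
move=> T f1 f2 proT cf1 cf2 fk; have [_ hT _ _] := proT.
have [x|phi [phi1 phi2 phiu]] :=
    univ T (f1 \o completion_unit p) (f2 \o completion_unit p) _.
  by have := fk (completion_unit p x); rewrite /= !completion_map_unit.
have [f [cf fU]] := completion_extension phi proT.
have ext (H : groupType) (j : {hom H -> Gamma}) (g : {hom pro_p_completion p H -> T}) :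
    continuous g -> phi \o j =1 g \o completion_unit p ->
    f \o completion_map p j =1 g.
  move=> cg e; apply: completion_continuous_eq => [|x||x /=] //.
    apply: continuous_comp; [exact: completion_map_continuous|exact: cf].
  by rewrite completion_map_unit; exact: etrans (fU _) (e x).
exists f; split=> //; [exact: ext|exact: ext|].
move=> g cg g1 g2; apply: completion_continuous_eq => // x.
rewrite [RHS]fU; apply: (phiu (g \o completion_unit p)) => y /=.
  by rewrite -completion_map_unit [LHS]g1.
by rewrite -completion_map_unit [LHS]g2.
Qed.

End Main.

Lemma completion_map_range_closed (p : nat) (G H : groupType) (f : {hom G -> H}) :
  closed (range (completion_map p f)).
Proof.
apply: compact_closed; first exact: completion_hausdorff.
apply: continuous_compact; last exact: completion_compact.
by apply: continuous_subspaceT; exact: completion_map_continuous.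
Qed.

Lemma closure_unit_range (p : nat) (G H : groupType) (f : {hom G -> H}) :
  closure (completion_unit p @` range f) `<=` range (completion_map p f).
Proof.
apply: subset_trans (@completion_map_range_closed p G H f).
apply: closureS => _ [_ [g _ <-] <-].
by exists (completion_unit p g); rewrite // completion_map_unit.
Qed.

(** The target group of the universal property is the completion of the finite
p-group [T] that separates, for each index [N] of [Gamma], the image of [K] in
[Gamma / N] from its complement. Comparing components at the trivial subgroup
of [T] shows that the component of [z] at [N] is that of an element of [K]. *)
Lemma pushout_closure_inter (p : nat) (K H1 H2 Gamma : groupType)
    (k1 : {hom K -> H1}) (k2 : {hom K -> H2})
    (j1 : {hom H1 -> Gamma}) (j2 : {hom H2 -> Gamma})
    (P : topologicalGroupType)
    (i1 : {hom pro_p_completion p H1 -> P})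
    (i2 : {hom pro_p_completion p H2 -> P})
    (f : {hom P -> pro_p_completion p Gamma}) :
  prime p -> j1 \o k1 =1 j2 \o k2 ->
  is_pro_p_pushout p (completion_map p k1) (completion_map p k2) i1 i2 ->
  f \o i1 =1 completion_map p j1 -> f \o i2 =1 completion_map p j2 ->
  injective f ->
  closure (completion_unit p @` range j1) `&`
  closure (completion_unit p @` range j2) `<=`
  closure (completion_unit p @` range (j1 \o k1)).
Proof.
move=> pp jk [_ _ _ _ univ] fi1 fi2 fI z.
move=> [/closure_unit_range[x1 _ zx1] /closure_unit_range[x2 _ zx2]].
have ix : i1 x1 = i2 x2.
  by apply: fI; rewrite [LHS]fi1 [RHS]fi2 zx1.
move=> A /completion_nbhsP[N sNA].
suff [k Nk] : exists k, component (completion_unit p (j1 (k1 k))) N = component z N.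
  exists (completion_unit p (j1 (k1 k))).
  by split; [exists (j1 (k1 k)); first exists k|exact: sNA].
have [Q [q [pQ _ qE]]] := p_normal_quotient (set_valP N).
have [T [s [t [pT sI st sep]]]] := range_equalizer_p_group (q \o (j1 \o k1)) pp pQ.
pose phi1 : {hom H1 -> T} := s \o (q \o j1).
pose phi2 : {hom H2 -> T} := t \o (q \o j2).
have phik : phi1 \o k1 =1 phi2 \o k2.
  by move=> k; have /= := st k; rewrite -[j2 (k2 k)]jk.
have [F [_ F1 F2 _]] := univ _ (completion_map p phi1) (completion_map p phi2)
  (@completion_is_pro_p p T) (@completion_map_continuous p _ _ phi1)
  (@completion_map_continuous p _ _ phi2) (completion_map_comp_eq phik).
have e : completion_map p phi1 x1 = completion_map p phi2 x2.
  by rewrite -[LHS]F1 -[RHS]F2 /= ix.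
(* The trivial subgroup of [T], as the kernel of the identity. *)
pose E : quotient_index p T :=
  SigSub (mem_set (@p_normal_kernel p T T id pT (fun _ _ => erefl))).
have [g1 xg1] := component_inhabited x1 (preimage_index phi1 E).
have [g2 xg2] := component_inhabited x2 (preimage_index phi2 E).
have [] : q (j1 g1) = q (j2 g2) /\ range (q \o (j1 \o k1)) (q (j1 g1)).
  apply: sep.
  have := component_map xg1; rewrite e (component_map xg2).
  move=> /(left_coset_eqP (quotient_index_normal E)) /= e12.
  by apply: (@mulgI _ (phi2 g2)^-1); rewrite mulVg.
move=> _ [k _ qk]; exists k.
have sE : val (preimage_index phi1 E) `<=` val (preimage_index j1 N).
  by move=> g /= sg1; apply/qE/sI; rewrite sg1 gmulf1.
rewrite -zx1 (component_map (componentS sE xg1)).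
apply/(left_coset_eqP (quotient_index_normal N))/qE.
by rewrite gmulfM gmulfV -qk mulVg.
Qed.

Theorem theorem6p2 (p : nat) (p_prime : prime p)
    (K H1 H2 Gamma : groupType)
    (k1 : {hom K -> H1}) (k2 : {hom K -> H2})
    (j1 : {hom H1 -> Gamma}) (j2 : {hom H2 -> Gamma}) :
  is_amalgam k1 k2 j1 j2 ->
  (exact_pro_p_entrance p k1 k2 j1 j2 <->
     [/\ p_embedded p (range k1), p_embedded p (range k2),
         p_embedded p (range j1) & p_embedded p (range j2)]) /\
  (exact_pro_p_entrance p k1 k2 j1 j2 ->
     closure (completion_unit p @` range j1) `&`
     closure (completion_unit p @` range j2) =
     closure (completion_unit p @` range (j1 \o k1))).
Proof.
move=> amalg; have [k1I k2I jk _] := amalg.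
split; first split.
- move=> [kI1 kI2 [P [i1 [i2 [_ iI1 iI2 [f [fi1 fi2 [_ [g [fK _ _]]]]]]]]]].
  have fI := can_inj fK.
  split; apply: p_embedded_of_completion_map_inj => //.
    by apply: eq_inj fi1; exact: inj_comp.
  by apply: eq_inj fi2; exact: inj_comp.
- move=> [ek1 ek2 ej1 ej2].
  have j1I := amalgam_inj amalg.
  have j2I := amalgam_inj (is_amalgam_sym amalg).
  split; [exact: completion_map_inj|exact: completion_map_inj|].
  exists (pro_p_completion p Gamma), (completion_map p j1), (completion_map p j2).
  split; [exact: completion_pushout|exact: completion_map_inj|exact: completion_map_inj|].
  exists idfun; split=> //; split; first by move=> x; exact: cvg_id.
  by exists id; split=> // x; exact: cvg_id.
- move=> [_ _ [P [i1 [i2 [push _ _ [f [fi1 fi2 [_ [g [fK _ _]]]]]]]]]].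
  apply/seteqP; split.
    exact: pushout_closure_inter push fi1 fi2 (can_inj fK).
  move=> x cx; split; apply: closureS cx => _ [_ [k _ <-] <-].
    by exists (j1 (k1 k)) => //; exists (k1 k).
  by exists (j1 (k1 k)) => //; exists (k2 k); rewrite // -[LHS]jk.
Qed.
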